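(* Let $\mathcal{C}$ be an unmixed clutter without cycles of length $3$ or $4$. If $e_1,\ldots,e_g$ is a perfect matching of $\mathcal{C}$ of König type, then $e_i$ has a free vertex for all $i$.
   Context: A clutter $\mathcal{C}$ with finite vertex set $X=\{x_1,\ldots,x_n\}$ is a family $E(\mathcal{C})$ of subsets of $X$, called edges, none of which is included in another. The edge ideal $I(\mathcal{C})$ is the ideal of the polynomial ring $R=K[x_1,\ldots,x_n]$ over a field $K$ generated by the monomials $\prod_{x_i\in e}x_i$, $e\in E(\mathcal{C})$. A vertex cover of $\mathcal{C}$ is a subset of $X$ meeting every edge; it is minimal if no proper subset is a vertex cover. The height of $I(\mathcal{C})$ equals the minimum size of a vertex cover. $\mathcal{C}$ is unmixed if all its minimal vertex covers have the same size. A perfect matching of König type of $\mathcal{C}$ is a collection $e_1,\ldots,e_g$ of pairwise disjoint edges whose union is $X$ and such that $g$ is the height of $I(\mathcal{C})$. The incidence matrix of $\mathcal{C}$, with edges $g_1,\ldots,g_q$, is $A=(a_{ij})$ with $a_{ij}=1$ if $x_i\in g_j$ and $a_{ij}=0$ otherwise. $\mathcal{C}$ has a cycle of length $r$ (where $r\geq 3$) if there is a square submatrix of $A$ of order $r$ with exactly two $1$'s in each row and column. A free vertex of $\mathcal{C}$ is a vertex that occurs in exactly one edge of $\mathcal{C}$; ``$e_i$ has a free vertex'' means some vertex of $e_i$ is a free vertex of $\mathcal{C}$. *)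

(* Defs.v *)
From HB Require Import structures.
From mathcomp Require Import all_boot all_order all_algebra.
From mathcomp Require Import mpoly.

Set Implicit Arguments.
Unset Strict Implicit.
Unset Printing Implicit Defensive.

Import GRing.Theory.
Local Open Scope ring_scope.

Section Height.

Variable R : comNzRingType.

(* [idealr_closed] includes 1 \notin P. Subsets of R are boolean predicates, as
   in ring_quotient. *)
Definition prime_ideal (P : {pred R}) : Prop :=
  idealr_closed P /\ prime_idealr_closed P.

(* A strictly increasing chain c 0 < c 1 < ... < c h = P of prime ideals;
   the values of c beyond h are irrelevant. *)
Definition prime_chain (P : {pred R}) (h : nat) (c : nat -> {pred R}) : Prop :=
  [/\ forall i, (i <= h)%N -> prime_ideal (c i),
      forall i, (i < h)%N ->
        {subset c i <= c i.+1} /\ ~ {subset c i.+1 <= c i}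
    & c h =i P].

Definition prime_height (P : {pred R}) (h : nat) : Prop :=
  (exists c, prime_chain P h c) /\
  (forall m c, prime_chain P m c -> (m <= h)%N).

Definition prime_over (I : R -> Prop) (P : {pred R}) : Prop :=
  prime_ideal P /\ (forall p, I p -> p \in P).

(* The height of an ideal is the minimum of the heights of the primes that
   contain it. Primes of infinite height satisfy no [prime_height P h], and
   the unit ideal has no (finite) height. *)
Definition ideal_height (I : R -> Prop) (h : nat) : Prop :=
  (exists2 P, prime_over I P & prime_height P h) /\
  (forall P k, prime_over I P -> prime_height P k -> (h <= k)%N).

End Height.

Section Clutter.

Variable n : nat.
Implicit Types (E : {set {set 'I_n}}) (C : {set 'I_n}).

Definition is_clutter E : Prop :=
  forall e f, e \in E -> f \in E -> e \subset f -> e = f.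

Definition vertex_cover E : pred {set 'I_n} :=
  fun C => [forall e in E, C :&: e != set0].

Definition minimal_vertex_cover E : pred {set 'I_n} :=
  minset (vertex_cover E).

Definition unmixed E : Prop :=
  forall C D, minimal_vertex_cover E C -> minimal_vertex_cover E D ->
    #|C| = #|D|.

Definition edge_monomial (K : fieldType) (e : {set 'I_n}) : {mpoly K[n]} :=
  \prod_(i in e) 'X_i.

Definition edge_ideal (K : fieldType) E (p : {mpoly K[n]}) : Prop :=
  exists a : {set 'I_n} -> {mpoly K[n]},
    p = \sum_(e in E) a e * edge_monomial K e.

Definition konig_perfect_matching (K : fieldType) E (g : nat)
    (e : 'I_g -> {set 'I_n}) : Prop :=
  [/\ forall i, e i \in E,
      forall i j, i != j -> [disjoint e i & e j],
      \bigcup_(i < g) e i = [set: 'I_n]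
    & ideal_height (edge_ideal (K := K) E) g].

Definition incidence_matrix E : 'M[nat]_(n, #|E|) :=
  \matrix_(i, j) (i \in (enum_val j : {set 'I_n}) : nat).

Definition has_cycle E (r : nat) : Prop :=
  (3 <= r)%N /\
  exists (rows : 'I_r -> 'I_n) (cols : 'I_r -> 'I_#|E|),
    let B := mxsub rows cols (incidence_matrix E) in
    [/\ injective rows, injective cols,
        forall i, #|[set j | B i j == 1%N]| = 2%N
      & forall j, #|[set i | B i j == 1%N]| = 2%N].

Definition free_vertex E (x : 'I_n) : Prop :=
  #|[set e in E | x \in e]| = 1%N.

End Clutter.

(* Main.v *)
Require Import Defs.
From mathcomp Require Import all_boot all_order all_algebra.
From mathcomp Require Import mpoly.

Set Implicit Arguments.
Unset Strict Implicit.
Unset Printing Implicit Defensive.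

(** The hypothesis on the height only enters through vertex covers. If a prime
    P of height g contains the edge ideal, the variables lying in P form a
    vertex cover C, and killing the variables of C one at a time yields a chain
    of |C| proper inclusions of primes below P; hence |C| <= g
    ([card_vars_le_prime_height]). As g pairwise disjoint edges force every
    cover to have at least g vertices, C contains a minimal cover of size g,
    and unmixedness makes every minimal cover have size g. So a minimal cover
    meets each matching edge in exactly one vertex.

    This gives an exchange property ([unmixed_exchange]): if x <> y lie in the
    same matching edge and f1, f2 are edges containing x and y respectively,
    then (f1 \ x) U (f2 \ y) contains an edge. Otherwise its complement is a
    cover; a minimal cover inside that complement can only meet f1 in x and
    only meet f2 in y, so it has two vertices in a single matching edge.

    Suppose now that no vertex of a matching edge e is free: every vertex of e
    lies in another edge. Choose an edge f1 <> e with f1 :&: e as large as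
    possible, then y in e \ f1, an edge f2 <> e through y and, by maximality, x
    in (f1 :&: e) \ f2. The exchange property provides an edge h, and the
    vertices of h outside e, f1 or f2 close up a cycle of length 3 or 4 among
    e, f1, f2, h ([short_cycle_of_no_free_vertex]). *)

(** * Heights of primes and the variables they contain *)

Section PrimeHeight.

Import GRing.Theory.
Local Open Scope ring_scope.

Lemma kernel_prime_ideal (R : comNzRingType) (S : idomainType)
    (f : {rmorphism R -> S}) : prime_ideal [pred p | f p == 0].
Proof.
split; last by move=> u v; rewrite !inE rmorphM mulf_eq0.
split=> [||a u v]; rewrite !inE ?rmorph0 ?rmorph1 ?oner_eq0 //.
by move=> /eqP fu /eqP fv; rewrite rmorphD rmorphM fu fv mulr0 addr0.
Qed.

(** The identity and the substitution induce the same map modulo P, because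
    they do so on the generators. *)
Lemma sub_mmap_in_ideal (n : nat) (R : comNzRingType) (P : {pred {mpoly R[n]}})
    (h : 'I_n -> {mpoly R[n]}) (p : {mpoly R[n]}) :
  idealr_closed P -> (forall i, 'X_i - h i \in P) ->
  p - mmap (@mpolyC n R) h p \in P.
Proof.
case=> P0 _ Plin Ph.
have PM a u : u \in P -> a * u \in P by move=> Pu; rewrite -[_ * _]addr0 Plin.
have congD a a' b b' : a - a' \in P -> b - b' \in P ->
    (a + b) - (a' + b') \in P.
  by move=> Pa Pb; rewrite opprD addrACA -[a - a']mul1r Plin.
have congM a a' b b' : a - a' \in P -> b - b' \in P -> a * b - a' * b' \in P.
  move=> Pa Pb.
  have -> : a * b - a' * b' = a * (b - b') + b' * (a - a').
    by rewrite !mulrBr [b' * a]mulrC [b' * a']mulrC addrA subrK.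
  by rewrite Plin // PM.
rewrite {1}[p]mpolyE /mmap.
elim/big_ind2: _ => [|a a' b b'|m _]; rewrite ?subr0 //; first exact: congD.
rewrite -mul_mpolyC; apply: (congM); rewrite ?subrr //.
rewrite mpolyXE_id /mmap1.
elim/big_ind2: _ => [|a a' b b'|i _]; rewrite ?subrr //; first exact: congM.
elim: (m i) => [|k IHk]; rewrite ?expr0 ?subrr // !exprS.
exact: congM.
Qed.

Definition kill_vars (n : nat) (K : fieldType) (S : {set 'I_n}) :
    {mpoly K[n]} -> {mpoly K[n]} :=
  mmap (@mpolyC n K) (fun i => if i \in S then 0 else 'X_i).

(** The ideal generated by the variables of S, presented as a kernel so that
    its primality is immediate. *)
Definition var_ideal (n : nat) (K : fieldType) (S : {set 'I_n}) :
    {pred {mpoly K[n]}} :=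
  [pred p | kill_vars S p == 0].

Section VarIdeal.

Variables (n : nat) (K : fieldType).
Implicit Types (S T : {set 'I_n}) (P : {pred {mpoly K[n]}}).

Lemma var_ideal_prime S : prime_ideal (@var_ideal n K S).
Proof. exact: (kernel_prime_ideal (mmap (@mpolyC n K) _)). Qed.

Lemma mem_var_ideal S i : ('X_i \in @var_ideal n K S) = (i \in S).
Proof.
rewrite inE /kill_vars mmapX mmap1U.
case: ifP => // _; rewrite ?eqxx //.
by apply/negP => /eqP/(congr1 (mcoeff U_(i)))/eqP;
  rewrite mcoeffX eqxx mcoeff0 oner_eq0.
Qed.

Lemma var_ideal_sub S P :
  idealr_closed P -> (forall i, i \in S -> 'X_i \in P) ->
  {subset @var_ideal n K S <= P}.
Proof.
move=> Pid PS p; rewrite inE => /eqP killp.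
rewrite -[p]subr0 -killp; apply: sub_mmap_in_ideal => // i.
by case: ifP => iS; rewrite ?subr0 ?subrr ?PS //; case: Pid.
Qed.

(** The ideals generated by the first k variables of P, for k < #|C|, followed
    by P itself, form a strictly increasing chain: the k-th inclusion is strict
    because the k-th variable enters there. *)
Lemma card_vars_le_prime_height P h :
  prime_ideal P -> prime_height P h -> (#|[set i | 'X_i \in P]| <= h)%N.
Proof.
move=> primeP [_ maxh]; set C := [set i | _].
have [Pid _] := primeP.
pose S k := [set i in take k (enum C)].
have SC k i : i \in S k -> 'X_i \in P.
  by rewrite inE => /mem_take; rewrite mem_enum inE.
(* A chain has to end at P, so P replaces the ideal of all the variables in
   C, which it may strictly contain. *)
pose c k := if (k < #|C|)%N then @var_ideal n K (S k) else P.
apply: (maxh _ c); split=> [k _|k ltkC|]; last by rewrite /c ltnn.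
  by rewrite /c; case: ifP => // _; apply: var_ideal_prime.
have [i0 _] : exists i, i \in C by apply/card_gt0P; apply: leq_trans ltkC.
set i := nth i0 (enum C) k.
have ltkE : (k < size (enum C))%N by rewrite -cardE.
have iC : 'X_i \in P.
  by have := mem_nth i0 ltkE; rewrite mem_enum inE.
have iNS : i \notin S k.
  by rewrite inE in_take ?mem_nth // index_uniq ?enum_uniq // ltnn.
have iS : i \in S k.+1.
  by rewrite inE in_take ?mem_nth // index_uniq ?enum_uniq.
have subS : {subset S k <= S k.+1}.
  by move=> j; rewrite !inE (take_nth i0) // mem_rcons inE orbC => ->.
rewrite /c ltkC; split.
  case: ifP => _; apply: var_ideal_sub => //; last exact: SC.
    by case: (var_ideal_prime (S k.+1)).
  by move=> j /subS; rewrite mem_var_ideal.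
move=> /(_ 'X_i); rewrite mem_var_ideal (negPf iNS) => contra.
suff /contra : 'X_i \in (if (k.+1 < #|C|)%N then var_ideal (S k.+1) else P)
  by [].
by case: ifP => _; rewrite ?mem_var_ideal.
Qed.

End VarIdeal.

(** A prime that contains the monomial of an edge contains one of its
    variables. *)
Lemma prime_over_edge_ideal_cover (n : nat) (K : fieldType)
    (E : {set {set 'I_n}}) (P : {pred {mpoly K[n]}}) :
  prime_over (edge_ideal (K := K) E) P ->
  vertex_cover E [set i | 'X_i \in P].
Proof.
case=> [[[_ P1 _] Pprime] PE]; apply/forall_inP => f fE; apply/set0Pn.
have : edge_monomial K f \in P.
  apply: PE; exists (fun f' => (f' == f)%:R).
  rewrite (bigD1 f) //= eqxx mul1r big1 ?addr0 // => f' /andP[_ /negPf->].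
  by rewrite mul0r.
rewrite /edge_monomial -big_enum /=.
have: {subset enum f <= f} by move=> i; rewrite mem_enum.
elim: (enum f) => [|i s IHs] sf; first by rewrite big_nil (negPf P1).
rewrite big_cons => /Pprime/orP[Pi|]; last first.
  by apply: IHs => j js; apply: sf; rewrite inE js orbT.
by exists i; rewrite !inE Pi sf ?mem_head.
Qed.

Lemma ideal_height_cover (n : nat) (K : fieldType) (E : {set {set 'I_n}}) g :
  ideal_height (edge_ideal (K := K) E) g ->
  exists2 C, vertex_cover E C & (#|C| <= g)%N.
Proof.
case=> [[P PE htP] _]; exists [set i | 'X_i \in P].
  exact: prime_over_edge_ideal_cover PE.
by case: PE => primeP _; apply: card_vars_le_prime_height.
Qed.

End PrimeHeight.

(** * Minimal covers of an unmixed clutter with a perfect matching *)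

Section Matching.

Variables (n g : nat) (E : {set {set 'I_n}}) (e : 'I_g -> {set 'I_n}).
Hypotheses (edge_e : forall i, e i \in E)
           (disj_e : forall i j, i != j -> [disjoint e i & e j]).

Lemma card_cover_sum (C : {set 'I_n}) :
  \bigcup_(i < g) e i = [set: 'I_n] -> #|C| = \sum_(i < g) #|C :&: e i|.
Proof.
move=> cov.
have -> : #|C| = \sum_(x in C) \sum_(i < g) (x \in e i).
  rewrite -sum1_card; apply: eq_bigr => x _.
  have /bigcupP[i _ xi] : x \in \bigcup_(i < g) e i by rewrite cov.
  rewrite (bigD1 i) //= xi big1 // => j ji.
  by rewrite (disjointFl (disj_e ji)).
rewrite exchange_big /=; apply: eq_bigr => i _.
rewrite -sum1_card big_mkcond [RHS]big_mkcond /=.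
by apply: eq_bigr => x _; rewrite !inE; case: (x \in C); case: (x \in e i).
Qed.

(** Each of the g summands #|C :&: e i| is positive and their sum is at most
    g. *)
Lemma small_cover_meets_once (C : {set 'I_n}) :
  \bigcup_(i < g) e i = [set: 'I_n] -> vertex_cover E C -> #|C| <= g ->
  forall i, #|C :&: e i| = 1.
Proof.
move=> cov /forall_inP covC leCg.
have ge1 i : 1 <= #|C :&: e i| by rewrite card_gt0 covC ?edge_e.
have leq_i i : 1 <= #|C :&: e i| ?= iff (1 == #|C :&: e i|).
  exact/leqif_eq/ge1.
have := geq_leqif (leqif_sum (fun i (_ : true) => leq_i i)).
rewrite -card_cover_sum // sum1_card card_ord leCg => /esym/forallP onceC i.
exact/esym/eqP/onceC.
Qed.

End Matching.

(** The complement of (f1 \ x) U (f2 \ y) would otherwise be a cover, and a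
    minimal cover inside it is forced to contain both x and y. *)
Lemma unmixed_exchange (n : nat) (E : {set {set 'I_n}}) (m : {set 'I_n})
    (f1 f2 : {set 'I_n}) (x y : 'I_n) :
  (forall C, minimal_vertex_cover E C -> #|C :&: m| <= 1) ->
  f1 \in E -> f2 \in E -> x \in f1 -> y \in f2 -> x \in m -> y \in m ->
  x != y -> exists2 h, h \in E & h \subset (f1 :\ x) :|: (f2 :\ y).
Proof.
move=> once f1E f2E xf1 yf2 xm ym xy; apply/exists_inP; apply: contraT.
rewrite negb_exists_in => /forall_inP noedge.
have cov : vertex_cover E (~: ((f1 :\ x) :|: (f2 :\ y))).
  apply/forall_inP => h hE; have /subsetPn[z zh zN] := noedge h hE.
  by apply/set0Pn; exists z; rewrite in_setI zh in_setC zN.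
have [C minC /subsetP sCD] := minset_exists cov.
have /minsetP[/forall_inP covC _] := minC.
have xC : x \in C.
  have /set0Pn[z /setIP[zC zf1]] := covC f1 f1E.
  have := sCD z zC; rewrite !inE zf1 andbT negb_or negbK.
  by case/andP => /eqP <-.
have yC : y \in C.
  have /set0Pn[z /setIP[zC zf2]] := covC f2 f2E.
  have := sCD z zC; rewrite !inE zf2 andbT negb_or negbK.
  by case/andP => _ /eqP <-.
have := once C minC; rewrite leqNgt => /negP[].
have <- : #|[set x; y]| = 2 by rewrite cards2 xy.
apply/subset_leq_card/subsetP => z; rewrite !inE.
by case/orP => /eqP->; rewrite ?xC ?yC.
Qed.

(** * Short cycles around an edge without a free vertex *)

Section Cycles.

Variables (n : nat) (E : {set {set 'I_n}}).

Import GRing.Theory.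

(** Rows and columns are listed in cyclic order. The incidence pattern alone
    makes both lists injective: equal rows i <> j would give j = i + 1 and
    i = j + 1, hence 2 = 0 modulo the length. *)
Lemma cyclic_incidence_has_cycle (k : nat) (rows : 'I_k.+3 -> 'I_n)
    (cols : 'I_k.+3 -> {set 'I_n}) :
  (forall j, cols j \in E) ->
  (forall i j, (rows i \in cols j) = (j == i) || (j == (i + 1)%R)) ->
  has_cycle E k.+3.
Proof.
move=> colE inc.
have succ_neq (i : 'I_k.+3) : (i + 1)%R != i.
  by rewrite -subr_eq0 addrAC subrr add0r.
have no2cycle (i j : 'I_k.+3) :
    (j == i) || (j == (i + 1)%R) -> (i == j) || (i == (j + 1)%R) -> i = j.
  case/orP=> /eqP-> // /orP[/eqP<- //|].
  by rewrite eq_sym -addrA -subr_eq0 addrAC subrr add0r.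
split=> //; exists rows, (fun j => enum_rank_in (colE j) (cols j)).
have entry i j : (mxsub rows (fun j => enum_rank_in (colE j) (cols j))
    (incidence_matrix E) i j == 1) = (j == i) || (j == (i + 1)%R).
  by rewrite !mxE enum_rankK_in ?colE // inc; case: (_ || _).
split=> [i j eq_ij|i j|i|j].
- by apply: no2cycle; rewrite -inc; [rewrite eq_ij|rewrite -eq_ij];
    rewrite inc eqxx.
- move/(congr1 enum_val); rewrite !enum_rankK_in ?colE // => eq_ij.
  by apply: no2cycle; rewrite -inc; [rewrite -eq_ij|rewrite eq_ij];
    rewrite inc eqxx.
- under eq_finset => j do rewrite entry.
  rewrite -[RHS]/(true.+1) -(succ_neq i) eq_sym -cards2.
  by congr #|pred_of_set _|; apply/setP => j; rewrite !inE.
- under eq_finset => i do rewrite entry.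
  have -> : [set i | (j == i) || (j == (i + 1)%R)] = [set j; (j - 1)%R].
    by apply/setP => i; rewrite !inE [i == j]eq_sym [i == _]eq_sym subr_eq.
  by rewrite cards2 eq_sym subr_eq eq_sym succ_neq.
Qed.

Lemma has_cycle3 (x y z : 'I_n) (a b c : {set 'I_n}) :
  a \in E -> b \in E -> c \in E ->
  [/\ x \in a, x \in b & x \notin c] ->
  [/\ y \notin a, y \in b & y \in c] ->
  [/\ z \in a, z \notin b & z \in c] -> has_cycle E 3.
Proof.
move=> aE bE cE [xa xb /negPf xc] [/negPf ya yb yc] [za /negPf zb zc].
apply: (@cyclic_incidence_has_cycle 0
  (tnth [tuple x; y; z]) (tnth [tuple a; b; c])).
  by case=> [[|[|[|?]]] ?].
by case=> [[|[|[|?]]] ?] // [[|[|[|?]]] ?].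
Qed.

Lemma has_cycle4 (x y z t : 'I_n) (a b c d : {set 'I_n}) :
  a \in E -> b \in E -> c \in E -> d \in E ->
  [/\ x \in a, x \in b, x \notin c & x \notin d] ->
  [/\ y \notin a, y \in b, y \in c & y \notin d] ->
  [/\ z \notin a, z \notin b, z \in c & z \in d] ->
  [/\ t \in a, t \notin b, t \notin c & t \in d] -> has_cycle E 4.
Proof.
move=> aE bE cE dE [xa xb /negPf xc /negPf xd] [/negPf ya yb yc /negPf yd].
move=> [/negPf za /negPf zb zc zd] [ta /negPf tb /negPf tc td].
apply: (@cyclic_incidence_has_cycle 1
  (tnth [tuple x; y; z; t]) (tnth [tuple a; b; c; d])).
  by case=> [[|[|[|[|?]]]] ?].
by case=> [[|[|[|[|?]]]] ?] // [[|[|[|[|?]]]] ?].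
Qed.

(** Take f1 <> m with f1 :&: m as large as possible, y in m \ f1 and f2 <> m
    through y. Maximality of f1 leaves some x in f1 :&: m outside f2, and the
    exchange property yields an edge h inside f1 U f2 that avoids x and y; it is
    contained in none of m, f1, f2, hence has a vertex v outside m. If v lies in
    f1 and in f2, then m, f1, f2 carry a triangle. If v lies in only one of
    them, say f1, take b in h \ f1, which lies in f2: if b is in m it closes the
    triangle m, f1, h, otherwise the square m, f1, h, f2. *)
Lemma short_cycle_of_no_free_vertex (m : {set 'I_n}) :
  is_clutter E -> m \in E -> m != set0 ->
  (forall f1 f2 x y, f1 \in E -> f2 \in E -> x \in f1 -> y \in f2 ->
    x \in m -> y \in m -> x != y ->
    exists2 h, h \in E & h \subset (f1 :\ x) :|: (f2 :\ y)) ->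
  (forall x, x \in m -> ~ free_vertex E x) ->
  has_cycle E 3 \/ has_cycle E 4.
Proof.
move=> clutter mE /set0Pn[x0 x0m] exchange nofree.
have other x : x \in m -> exists2 f, (f \in E) && (f != m) & x \in f.
  move=> xm; apply/exists_inP; apply: contra_notT (nofree x xm).
  rewrite negb_exists_in => /forall_inP only.
  rewrite /free_vertex; suff -> : [set f in E | x \in f] = [set m].
    exact: cards1.
  apply/setP => f; rewrite !inE; apply/andP/eqP => [[fE xf]|-> //].
  by apply/eqP; apply: contraLR xf => fm; apply: only; rewrite fE.
have notsub f h : f \in E -> h \in E -> f != h ->
    exists2 z, z \in f & z \notin h.
  by move=> fE hE fh; apply/subsetPn; apply: contraNN fh => /clutter->.
have [f0 f0E _] := other x0 x0m.
case: (@arg_maxnP _ f0 (fun f => (f \in E) && (f != m)) (fun f => #|f :&: m|)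
  f0E) => f1 /andP[f1E f1m] maxf1.
have [y ym yf1] : exists2 y, y \in m & y \notin f1.
  by apply: notsub; rewrite // eq_sym.
have [f2 f2Em yf2] := other y ym; have /andP[f2E f2m] := f2Em.
have [x /setIP[xf1 xm] xf2] : exists2 x, x \in f1 :&: m & x \notin f2.
  apply/subsetPn; apply: contraL (maxf1 f2 f2Em) => /subsetP sub.
  rewrite -ltnNge; apply: proper_card; apply/properP; split.
    by apply/subsetP => z zI; rewrite inE sub //; case/setIP: zI.
  by exists y; rewrite !inE ?ym ?yf2 // (negPf yf1).
have xy : x != y by apply: contraNneq xf2 => ->.
have [h hE /subsetP subh] := exchange _ _ _ _ f1E f2E xf1 yf2 xm ym xy.
have hf z : z \in h -> (z \in f1) || (z \in f2).
  by move/subh; rewrite !inE => /orP[]/andP[_ ->]; rewrite ?orbT.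
have xh : x \notin h.
  by apply/negP => /subh; rewrite !inE eqxx (negPf xf2) andbF.
have yh : y \notin h.
  by apply/negP => /subh; rewrite !inE eqxx (negPf yf1) andbF.
have neq z (f f' : {set 'I_n}) : z \in f -> z \notin f' -> f' != f.
  by move=> zf; apply: contraNneq => ->.
have [v vh vm] := notsub h m hE mE (neq _ _ _ xm xh).
have [a ah af2] := notsub h f2 hE f2E (neq _ _ _ yf2 yh).
have [b bh bf1] := notsub h f1 hE f1E (neq _ _ _ xf1 xh).
have af1 : a \in f1 by have := hf a ah; rewrite (negPf af2) orbF.
have bf2 : b \in f2 by have := hf b bh; rewrite (negPf bf1).
have [vf1|vf1] := boolP (v \in f1); have [vf2|vf2] := boolP (v \in f2).
- by left; apply: (has_cycle3 (x := x) (y := v) (z := y) mE f1E f2E); split.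
- have [bm|bm] := boolP (b \in m).
    by left; apply: (has_cycle3 (x := x) (y := v) (z := b) mE f1E hE); split.
  right; apply: (has_cycle4 (x := x) (y := v) (z := b) (t := y)
    mE f1E hE f2E); by split.
- have [am|am] := boolP (a \in m).
    by left; apply: (has_cycle3 (x := y) (y := v) (z := a) mE f2E hE); split.
  right; apply: (has_cycle4 (x := y) (y := v) (z := a) (t := x)
    mE f2E hE f1E); by split.
- by have := hf v vh; rewrite (negPf vf1) (negPf vf2).
Qed.

End Cycles.

Theorem proposition2p14 (K : fieldType) (n : nat) (E : {set {set 'I_n}})
    (hclutter : is_clutter E) (hunmixed : unmixed E)
    (hcycle3 : ~ has_cycle E 3) (hcycle4 : ~ has_cycle E 4)
    (g : nat) (e : 'I_g -> {set 'I_n})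
    (hmatching : konig_perfect_matching K E e) :
  forall i : 'I_g, exists2 x : 'I_n, x \in e i & free_vertex E x.
Proof.
case: hmatching => eE disj cov /ideal_height_cover[C0 covC0 leC0].
have [C1 minC1 subC1] := minset_exists covC0.
have once C i : minimal_vertex_cover E C -> #|C :&: e i| = 1.
  move=> minC; have /minsetP[covC _] := minC.
  apply: small_cover_meets_once => //.
  by rewrite (hunmixed C C1) //; apply: leq_trans (subset_leq_card subC1) leC0.
move=> i.
suff /exists_inP[x xi /eqP free_x] :
    [exists x in e i, #|[set f in E | x \in f]| == 1] by exists x.
apply: contraT => /exists_inPn nofree.
have ei0 : e i != set0.
  have /minsetP[/forall_inP covC1 _] := minC1.
  by have := covC1 _ (eE i); apply: contraNneq => ->; rewrite setI0.
have [||//|//] := short_cycle_of_no_free_vertex hclutter (eE i) ei0.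
- move=> f1 f2 x y; apply: unmixed_exchange => C minC.
  by rewrite (once C i minC).
- by move=> x xi free_x; have /eqP[] := nofree x xi.
Qed.
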